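(* Let $t_0<T$ be integers and $\beta\in(0,1]$. Assume that the random variables $w(t_0),\dots,w(T)$ are independent and identically distributed under the probability $\mathbb{P}$, with common marginal distribution $\mu$. Let $V$ be the stochastic viability value function, and assume that for any time $t=t_0,\dots,T-1$ and any state $x\in\mathbb{R}^n$ the set $$\mathbb{B}^{\rm viab}(t,x)=\arg\max_{u\in\mathbb{B}(t,x)}\mathbb{E}_\mu\Big[\mathbf{1}_{\mathbb{A}(t,w)}(x)\,V\big(t+1,f(t,x,u,w)\big)\Big]$$ is not empty. Then, for any $x_0\in\mathbb{V}\mathrm{iab}_\beta(t_0)$, any measurable selection $\mathfrak{u}^\star$ of $\mathbb{B}^{\rm viab}$ (that is, any measurable feedback $\mathfrak{u}^\star\in\mathfrak{U}$ such that $\mathfrak{u}^\star(t,x)\in\mathbb{B}^{\rm viab}(t,x)$ for all $t\in\{t_0,\dots,T-1\}$ and $x\in\mathbb{R}^n$) belongs to the set $\mathfrak{U}_\beta^{\rm viab}(t_0,x_0)$ of stochastic viable feedbacks.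
   Context: Data. Integers $t_0<T$; state space $\mathbb{X}=\mathbb{R}^n$, control space $\mathbb{U}=\mathbb{R}^p$, disturbance space $\mathbb{W}=\mathbb{R}^q$. The dynamics is $x(t+1)=f(t,x(t),u(t),w(t))$ for $t=t_0,\dots,T-1$, with $f$ taking values in $\mathbb{X}$. For each $(t,x)$, $\mathbb{B}(t,x)\subset\mathbb{U}$ is a nonempty set of admissible controls. For each $t\in\{t_0,\dots,T\}$ and $w$, $\mathbb{A}(t,w)\subset\mathbb{X}$ is a nonempty, possibly uncertain, set of admissible states (the target when $t=T$). Disturbances satisfy $w(t)\in\mathbb{S}(t)\subset\mathbb{W}$. Scenarios are the sequences $w(\cdot)=(w(t_0),\dots,w(T))\in\Omega=\mathbb{S}(t_0)\times\cdots\times\mathbb{S}(T)$, and $\Omega$ carries the trace of the Borel $\sigma$-field and a probability $\mathbb{P}$. The i.i.d. assumption means $\mathbb{P}=\bigotimes_{t=t_0}^{T}\mu$, where $\mu$ is a common marginal distribution. $\mathbb{E}_\mu$ denotes expectation over a single disturbance $w$ with law $\mu$. $\mathbf{1}_A$ is the indicator function of $A$. Feedbacks. $\mathfrak{U}$ is the set of all measurable maps $\mathfrak{u}:\{t_0,\dots,T-1\}\times\mathbb{X}\to\mathbb{U}$, and $\mathfrak{U}^{\rm ad}=\{\mathfrak{u}\in\mathfrak{U}:\mathfrak{u}(t,x)\in\mathbb{B}(t,x)\ \text{for all }(t,x)\}$. Given $\mathfrak{u}\in\mathfrak{U}$, $w(\cdot)\in\Omega$ and $x_0\in\mathbb{X}$,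 the state path $x_f[t_0,x_0,\mathfrak{u},w(\cdot)]$ is the sequence $(x(t_0),\dots,x(T))$ with $x(t_0)=x_0$ and $x(t+1)=f(t,x(t),\mathfrak{u}(t,x(t)),w(t))$ for $t=t_0,\dots,T-1$. Stochastic viable feedbacks and viability kernel. For $\beta\in(0,1]$ and $x_0\in\mathbb{X}$, $$\mathfrak{U}_\beta^{\rm viab}(t_0,x_0)=\Big\{\mathfrak{u}\in\mathfrak{U}^{\rm ad}:\ \mathbb{P}\big(w(\cdot)\in\Omega\mid x(t)\in\mathbb{A}(t,w(t))\text{ for }t=t_0,\dots,T\big)\ge\beta\Big\},$$ where $x(t)=x_f[t_0,x_0,\mathfrak{u},w(\cdot)](t)$; the bar means ''such that'' (this is the probability of the set of scenarios, not a conditional probability). The stochastic viability kernel $\mathbb{V}\mathrm{iab}_\beta(t_0)$ is the set of $x_0\in\mathbb{X}$ for which there exists $\mathfrak{u}\in\mathfrak{U}^{\rm ad}$ satisfying this same probability inequality. Stochastic viability value function. $V$ is defined on $\{t_0,\dots,T\}\times\mathbb{X}$ by the backward induction $$V(T,x)=\mathbb{E}_\mu\big[\mathbf{1}_{\mathbb{A}(T,w)}(x)\big],\qquad V(t,x)=\max_{u\in\mathbb{B}(t,x)}\mathbb{E}_\mu\big[\mathbf{1}_{\mathbb{A}(t,w)}(x)\,V(t+1,f(t,x,u,w))\big],\quad t=t_0,\dots,T-1.$$ Standing assumptions. All objects have the appropriate measurability: $f(t,\cdot,\cdot,\cdot)$, the map $(x,w)\mapsto\mathbf{1}_{\mathbb{A}(t,w)}(x)$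 and $V(t,\cdot)$ are measurable for every $t$. *)

(* Defs.v *)
From HB Require Import structures.
From mathcomp Require Import all_boot all_order all_algebra finmap.
From mathcomp Require Import all_classical all_reals all_analysis measurable_realfun.

Set Implicit Arguments.
Unset Strict Implicit.
Unset Printing Implicit Defensive.

Import Order.TTheory GRing.Theory Num.Theory.
Import numFieldNormedType.Exports.

Local Open Scope classical_set_scope.
Local Open Scope ring_scope.

(* R^n is [n.-tuple R]: the library equips it with the sigma-algebra generated
   by the coordinates from the Borel sets of R, i.e. with the Borel
   sigma-field of R^n.

   Time is [int].  Families that the mathematics indexes by {t0, ..., T} or
   {t0, ..., T-1} are total functions on [int] whose values outside that range
   are never used. *)

Section probability_notions.
Context d d' (Om : measurableType d) (E : measurableType d') (R : realType).
Variables (P : probability Om R) (I : choiceType) (D : set I) (X : I -> Om -> E).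

(* Joint independence of the family [X], indexed by [D]. *)
Definition mutually_independent : Prop :=
  forall (J : {fset I}) (F : I -> set E),
    [set` J] `<=` D -> (forall i, measurable (F i)) ->
    P (\bigcap_(i in [set` J]) (X i @^-1` F i)) =
    (\prod_(i <- J) P (X i @^-1` F i))%E.

Definition identically_distributed (mu : probability E R) : Prop :=
  forall i, D i -> forall F : set E, measurable F -> P (X i @^-1` F) = mu F.

Definition iid (mu : probability E R) : Prop :=
  mutually_independent /\ identically_distributed mu.

End probability_notions.

Section scenarios.
Context (R : realType) (q : nat) (t0 T : int) (S : int -> set (q.-tuple R)).

(* A sequence (w(t0), ..., w(T)) is stored as a tuple of length T - t0 + 1,
   and w(t) is its entry of rank t - t0. *)
Definition disturbances : Type := (absz (T - t0)).+1.-tuple (q.-tuple R).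

Definition coord (t : int) (w : disturbances) : q.-tuple R :=
  tnth w (inord (absz (t - t0))).

Definition scenario_set : set disturbances :=
  [set w | forall t, t0 <= t <= T -> S t (coord t w)].

(* Omega as a type.  Nonemptiness, which any probability on Omega forces, is
   only there because the measurable types of the library are pointed. *)
Definition scenario (Omega_neq0 : scenario_set !=set0) : Type := set_type scenario_set.

Variable Omega_neq0 : scenario_set !=set0.

Definition scenario_val (w : scenario Omega_neq0) : disturbances := val w.

Definition scenario_point : scenario Omega_neq0 :=
  SigSub (mem_set (svalP (cid Omega_neq0))).

HB.instance Definition _ := Choice.copy (scenario Omega_neq0) (set_type scenario_set).
HB.instance Definition _ := isPointed.Build (scenario Omega_neq0) scenario_point.

(* The trace on Omega of the Borel sigma-field of the disturbance sequences. *)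
HB.instance Definition _ := Measurable.copy (scenario Omega_neq0)
  (g_sigma_algebra_preimageType
    (scenario_val : scenario Omega_neq0 -> (absz (T - t0)).+1.-tuple (q.-tuple R))).

Definition disturbance (t : int) (w : scenario Omega_neq0) : q.-tuple R :=
  coord t (scenario_val w).

End scenarios.
Arguments scenario_set {R q} t0 T S.

Section viability.
Context (R : realType) (n p q : nat) (t0 T : int).
Local Notation X := (n.-tuple R).
Local Notation U := (p.-tuple R).
Local Notation W := (q.-tuple R).
Variables (f : int -> X -> U -> W -> X) (B : int -> X -> set U)
  (A : int -> W -> set X).

Definition feedback : set (int -> X -> U) :=
  [set u | forall t, t0 <= t < T -> measurable_fun [set: X] (u t)].

Definition admissible_feedback : set (int -> X -> U) :=
  [set u | feedback u /\ forall t x, t0 <= t < T -> B t x (u t x)].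

Section path.
Variables (x0 : X) (u : int -> X -> U) (w : int -> W).

Fixpoint state_after (k : nat) : X :=
  if k is k'.+1 then
    let t := t0 + k'%:Z in
    let x := state_after k' in f t x (u t x) (w t)
  else x0.

Definition state_path (t : int) : X := state_after (absz (t - t0)).

End path.

Section kernel.
Variables (S : int -> set W) (Omega_neq0 : scenario_set t0 T S !=set0).
Variables (P : probability (scenario Omega_neq0) R) (beta : R).

Definition viable_scenarios (x0 : X) (u : int -> X -> U) : set (scenario Omega_neq0) :=
  [set w | forall t, t0 <= t <= T ->
    A t (disturbance t w) (state_path x0 u (fun s => disturbance s w) t)].

Definition viable_feedback (x0 : X) : set (int -> X -> U) :=
  [set u | admissible_feedback u /\ (beta%:E <= P (viable_scenarios x0 u))%E].

Definition viability_kernel : set X :=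
  [set x0 | exists u, admissible_feedback u /\
    (beta%:E <= P (viable_scenarios x0 u))%E].

End kernel.

Section value.
Variable mu : probability W R.
Local Open Scope ereal_scope.

(* E_mu [1_{A(t,w)}(x) v(f(t,x,u,w))] *)
Definition expected_value (v : X -> \bar R) (t : int) (x : X) (u : U) : \bar R :=
  \int[mu]_w ((\1_(A t w) x)%:E * v (f t x u w)).

(* The value function at time T - k.  The maximum over B(t,x) is written as a
   supremum; the two coincide as soon as the argmax set is nonempty. *)
Fixpoint value_to_go (k : nat) : X -> \bar R :=
  if k is k'.+1 then
    fun x => let t := (T - k%:Z)%R in
      ereal_sup [set expected_value (value_to_go k') t x u | u in B t x]
  else fun x => \int[mu]_w (\1_(A T w) x)%:E.

Definition value_function (t : int) : X -> \bar R :=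
  value_to_go (absz (T - t)%R).

Definition viability_argmax (t : int) (x : X) : set U :=
  [set u | B t x u /\ forall v, B t x v ->
    expected_value (value_function (t + 1)%R) t x v <=
    expected_value (value_function (t + 1)%R) t x u].

End value.

End viability.

(* Main.v *)
Require Import Defs.
From HB Require Import structures.
From mathcomp Require Import all_boot all_order all_algebra finmap.
From mathcomp Require Import zify.
From mathcomp Require Import all_classical all_reals all_analysis measurable_realfun.

Set Implicit Arguments.
Unset Strict Implicit.
Unset Printing Implicit Defensive.

Import Order.TTheory GRing.Theory Num.Theory.
Import numFieldNormedType.Exports.

Local Open Scope classical_set_scope.
Local Open Scope ring_scope.

(* For a feedback u with path x(.), let D_t be the event that the state
   constraints hold strictly before time t, and consider
   E_P[1_{D_t} V(t, x(t))].  Since w(t) is independent of (1_{D_t}, x(t)) with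
   law mu, Fubini gives
     E_P[1_{D_{t+1}} V(t+1, x(t+1))]
       = E_P[1_{D_t} E_mu[1_{A(t,w)}(x(t)) V(t+1, f(t, x(t), u(t,x(t)), w))]].
   By the backward induction this is at most E_P[1_{D_t} V(t, x(t))], with
   equality when u(t, .) selects maximizers.  Going from T+1, with the
   convention V(T+1, .) = 1, down to t0, the viability probability of any
   admissible feedback is at most V(t0, x0), and it equals V(t0, x0) for
   ustar. *)

Lemma measurable_preimage d d' (T : measurableType d) (T' : measurableType d')
    (g : T -> T') (C : set T') :
  measurable_fun [set: T] g -> measurable C -> measurable (g @^-1` C).
Proof. by move=> mg mC; rewrite -[X in measurable X]setTI; exact: mg. Qed.

(** * Independence tested on rectangles, and Tonelli for an independent pair *)

Section independence.
Context d dS dW (Om : measurableType d) (St : measurableType dS)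
  (W : measurableType dW) (R : realType) (P : probability Om R).
Local Open Scope ereal_scope.

(** As functions of [K], both sides are finite measures that agree on measurable rectangles. These
    form a pi-system generating the product sigma-algebra, so uniqueness of measures applies. *)
Lemma indep_rectangles (Z : {mfun Om >-> (St * W)%type}) (E : set Om) :
  measurable E ->
  (forall C D, measurable C -> measurable D ->
     P (Z @^-1` (C `*` D) `&` E) = P (Z @^-1` (C `*` D)) * P E) ->
  forall K, measurable K -> P (Z @^-1` K `&` E) = P (Z @^-1` K) * P E.
Proof.
move=> mE ZE K mK.
have mZ := @measurable_funPT _ _ _ _ Z.
(* [mscale] scales by a nonnegative real, so the finite value [P E] is first turned into one. *)
pose c := NngNum (fine_ge0 (measure_ge0 P E)).
have cE : c%:num%:E = P E by rewrite /= fineK// fin_num_measure.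
(* [m1] is the restriction of [P] to [E], pushed forward along [Z]. *)
have [m1 m1E] : exists m1 : {measure set (St * W) -> \bar R},
    forall B, m1 B = P (Z @^-1` B `&` E).
  by unshelve eexists (pushforward (mrestr P mE) Z).
pose m2 : {measure set (St * W) -> \bar R} := mscale c (distribution P Z).
suff : m1 K = m2 K by rewrite m1E /m2 /= /mscale cE muleC.
apply: (measure_unique [set C `*` D | C in measurable & D in measurable]
  (fun=> setT)) => //.
- by rewrite measurable_prod_measurableType.
- move=> _ _ [C1 mC1 [D1 mD1 <-]] [C2 mC2 [D2 mD2 <-]].
  by rewrite -setXI; exists (C1 `&` C2); [exact: measurableI|];
    exists (D1 `&` D2) => //; exact: measurableI.
- by move=> _; exists setT => //; exists setT => //; rewrite setXTT.
- by rewrite bigcup_const.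
- move=> _ [C mC [D mD <-]].
  by rewrite m1E ZE// /m2 /= /mscale cE muleC.
- move=> _; rewrite m1E preimage_setT setTI.
  by rewrite (le_lt_trans (probability_le1 _ _))// ltry.
Qed.

(** The hypothesis identifies the law of [(X, Y)] on rectangles with the product of the law of [X]
    and [mu]. Uniqueness of the product measure extends this to all measurable sets, and Tonelli
    concludes. *)
Lemma expectation_indep (X : {mfun Om >-> St}) (Y : {mfun Om >-> W})
    (mu : probability W R) (h : St * W -> \bar R) :
  (forall C D, measurable C -> measurable D ->
     P (X @^-1` C `&` Y @^-1` D) = P (X @^-1` C) * mu D) ->
  measurable_fun [set: St * W] h -> (forall z, 0 <= h z) ->
  \int[P]_om h (X om, Y om) = \int[P]_om \int[mu]_w h (X om, w).
Proof.
move=> XY mh h0.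
have mXY : measurable_fun [set: Om] (fun om => (X om, Y om)).
  by apply: measurable_fun_pair; exact: measurable_funPT.
rewrite -[LHS](@ge0_integral_pushforward _ _ _ _ _ _ mXY P setT h)//.
transitivity (\int[distribution P X \x mu]_z h z).
  apply: eq_measure_integral => K mK _; apply/esym.
  by apply: product_measure_unique.
rewrite fubini_tonelli1//.
by rewrite ge0_integral_distribution//; [exact: measurable_fun_fubini_tonelli_F|
  move=> x; apply: integral_ge0].
Qed.

End independence.

(** * Markov chains driven by independent noises of law [mu] *)

Section markov_chain.
Context d dS dW (Om : measurableType d) (St : measurableType dS)
  (W : measurableType dW) (R : realType) (P : probability Om R)
  (mu : probability W R) (M : nat) (w : nat -> Om -> W)
  (G : nat -> St -> W -> St) (s0 : St).
Local Open Scope ereal_scope.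

Hypothesis mw : forall k, measurable_fun [set: Om] (w k).
Hypothesis mG : forall k, (k < M)%N ->
  measurable_fun [set: St * W] (fun z => G k z.1 z.2).
Hypothesis wP : forall F : nat -> set W, (forall k, measurable (F k)) ->
  P (\bigcap_(k in `I_M) (w k @^-1` F k)) = \prod_(0 <= k < M) mu (F k).

Fixpoint chain (k : nat) (om : Om) : St :=
  if k is k'.+1 then G k' (chain k' om) (w k' om) else s0.

Lemma measurable_chain k : (k <= M)%N -> measurable_fun [set: Om] (chain k).
Proof.
elim: k => [_|k IH kM]; first exact: measurable_cst.
have mkw : measurable_fun [set: Om] (fun om => (chain k om, w k om)).
  by apply: measurable_fun_pair => //; exact/IH/ltnW.
exact: (measurableT_comp (mG kM) mkw).
Qed.

Let future (F : nat -> set W) (k : nat) : set Om :=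
  \bigcap_(j in [set j | (k <= j < M)%N]) (w j @^-1` F j).

Lemma future_split F k : (k < M)%N ->
  future F k = w k @^-1` F k `&` future F k.+1.
Proof.
move=> kM; apply/seteqP; split=> [om fut|om [Fk fut] j /= /andP[kj jM]].
  split=> [|j /= /andP[kj jM]]; apply: fut => /=; first by rewrite leqnn.
  by rewrite ltnW.
move: kj; rewrite leq_eqVlt => /predU1P[<-//|kj].
by apply: fut; rewrite /= kj.
Qed.

(** [chain k.+1] is a function of [(chain k, w k)], so its independence from later noises follows
    from that of the pair. Carrying all remaining noises in the event, not just [w k], is what makes
    the induction on [k] go through. *)
Lemma chain_indep_future (F : nat -> set W) k (C : set St) :
  (forall j, measurable (F j)) -> (k <= M)%N -> measurable C ->
  P (chain k @^-1` C `&` future F k) =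
  P (chain k @^-1` C) * \prod_(k <= j < M) mu (F j).
Proof.
move=> + + mC; elim: k C mC F => [|k IH] C mC F mF kM.
  have -> : future F 0 = \bigcap_(k in `I_M) (w k @^-1` F k) by [].
  (* [chain 0] is the constant [s0], so the preimage of [C] is everything or empty. *)
  have [Cs0|Cs0] := pselect (C s0).
    have -> : chain 0 @^-1` C = setT by apply/seteqP; split.
    by rewrite setTI probability_setT mul1e wP.
  have -> : chain 0 @^-1` C = set0 by apply/seteqP; split.
  by rewrite set0I !measure0 mul0e.
have mfut i : measurable (future F i).
  by apply: bigcap_measurableType => j _; exact: measurable_preimage.
(* The induction hypothesis for the family [F'] with its entry of rank [k] replaced by [D]. Trivial
   [C'] and [D] give the probability of the future, a trivial [F'] gives the law of [(chain k, w k)]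
   on rectangles, and the general case gives the joint probability. *)
have key F' (mF' : forall j, measurable (F' j)) C' D : measurable C' -> measurable D ->
    P (chain k @^-1` C' `&` (w k @^-1` D `&` future F' k.+1)) =
    P (chain k @^-1` C') * (mu D * \prod_(k.+1 <= j < M) mu (F' j)).
  move=> mC' mD; pose F1 j := if j == k then D else F' j.
  have mF1 j : measurable (F1 j) by rewrite /F1; case: ifP.
  have := IH _ mC' F1 mF1 (ltnW kM).
  rewrite future_split// big_ltn// {1 3}/F1 eqxx => IHF1.
  rewrite (_ : future F' _ = future F1 k.+1); last first.
    apply: eq_bigcapr => j /= /andP[kj _].
    by rewrite /F1 gtn_eqF.
  rewrite IHF1; congr (_ * (_ * _)).
  rewrite big_nat_cond [RHS]big_nat_cond; apply: eq_bigr => j /andP[/andP[kj _] _].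
  by rewrite /F1 gtn_eqF.
have futT : future (fun=> setT) k.+1 = setT by apply/seteqP; split.
have prodT : \prod_(k.+1 <= j < M) mu setT = 1.
  by rewrite big1// => j _; rewrite probability_setT.
have Pfut : P (future F k.+1) = \prod_(k.+1 <= j < M) mu (F j).
  have := key F mF setT setT measurableT measurableT.
  by rewrite !preimage_setT !setTI !probability_setT !mul1e.
have mch := measurable_chain (ltnW kM).
pose Z : {mfun Om >-> (St * W)%type} := HB.pack (fun om => (chain k om, w k om))
  (isMeasurableFun.Build _ _ _ _ _ (measurable_fun_pair mch (mw k))).
rewrite -Pfut (_ : chain k.+1 @^-1` C = Z @^-1` ((fun z => G k z.1 z.2) @^-1` C))//.
apply: indep_rectangles => //; last exact: measurable_preimage (mG kM) mC.
move=> C' D mC' mD.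
have -> : Z @^-1` (C' `*` D) = chain k @^-1` C' `&` w k @^-1` D by [].
have := key _ (fun=> measurableT) C' D mC' mD.
rewrite futT prodT setIT mule1 => ->.
by rewrite -setIA key// Pfut muleA.
Qed.

(** With the future constrained only at rank [k], [chain_indep_future] says that [w k] has law [mu]
    and is independent of [chain k], so [w k] can be integrated out. *)
Lemma expectation_chain k (h : St * W -> \bar R) : (k < M)%N ->
  measurable_fun [set: St * W] h -> (forall z, 0 <= h z) ->
  \int[P]_om h (chain k om, w k om) = \int[P]_om \int[mu]_w h (chain k om, w).
Proof.
move=> kM mh h0.
pose X : {mfun Om >-> St} := HB.pack (chain k)
  (isMeasurableFun.Build _ _ _ _ _ (measurable_chain (ltnW kM))).
pose Y : {mfun Om >-> W} := HB.pack (w k) (isMeasurableFun.Build _ _ _ _ _ (mw k)).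
apply: (expectation_indep (X := X) (Y := Y)) => // C D mC mD.
pose F j := if j == k then D else setT.
have mF j : measurable (F j) by rewrite /F; case: ifP.
have := chain_indep_future mF (ltnW kM) mC.
rewrite future_split// (_ : future F k.+1 = setT); last first.
  apply/seteqP; split=> // om _ j /= /andP[kj _].
  by rewrite /F gtn_eqF.
rewrite setIT big_ltn// big_nat_cond big1 => [|j /andP[/andP[kj _] _]]; last first.
  by rewrite /F gtn_eqF// probability_setT.
by rewrite /F eqxx mule1.
Qed.

End markov_chain.

(** * Survival probability of a constrained chain, compared with a sequence of values *)

Section survival.
Context d dX dW (Om : measurableType d) (X : measurableType dX)
  (W : measurableType dW) (R : realType) (P : probability Om R)
  (mu : probability W R) (M : nat) (w : nat -> Om -> W)
  (g : nat -> X -> W -> X) (A : nat -> W -> set X) (x0 : X)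
  (v : nat -> X -> \bar R).
Local Open Scope ereal_scope.

Hypothesis mw : forall k, measurable_fun [set: Om] (w k).
Hypothesis wP : forall F : nat -> set W, (forall k, measurable (F k)) ->
  P (\bigcap_(k in `I_M) (w k @^-1` F k)) = \prod_(0 <= k < M) mu (F k).
Hypothesis mg : forall k, (k < M)%N ->
  measurable_fun [set: X * W] (fun z => g k z.1 z.2).
Hypothesis mA : forall k, (k < M)%N ->
  measurable_fun [set: X * W] (fun z => \1_(A k z.2) z.1 : R).
Hypothesis mv : forall k, (k <= M)%N -> measurable_fun [set: X] (v k).
Hypothesis v0 : forall k x, (k <= M)%N -> 0 <= v k x.

(** The inequality is strict because the constraint at rank [k] involves [w k]: this way the event
    depends only on the noises of rank below [k]. *)
Definition survival (k : nat) : set Om :=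
  [set om | forall j, (j < k)%N -> A j (w j om) (chain w g x0 j om)].

Definition one_step_value (k : nat) (x : X) : \bar R :=
  \int[mu]_e ((\1_(A k e) x)%:E * v k.+1 (g k x e)).

(* Recording survival as a real coordinate of the state makes the killed chain
   an ordinary Markov chain. *)
Let G (k : nat) (s : R * X) (e : W) : R * X :=
  ((s.1 * \1_(A k e) s.2)%R, g k s.2 e).

Lemma survivalS k om : (\1_(survival k.+1) om =
  \1_(survival k) om * \1_(A k (w k om)) (chain w g x0 k om) :> R)%R.
Proof.
rewrite !indicE -natrM mulnb; congr (_%:R%R); congr nat_of_bool.
apply/idP/andP; rewrite !inE.
  by move=> sv; split; [move=> j jk; exact/sv/ltnW|exact: sv].
by move=> -[sv Ak] j; rewrite ltnS leq_eqVlt => /predU1P[->|/sv].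
Qed.

Lemma chain_survival k om :
  chain w G (1%R, x0) k om = (\1_(survival k) om, chain w g x0 k om).
Proof.
elim: k => [|k IH] /=.
  by rewrite indicE mem_set.
by rewrite IH /G /= survivalS.
Qed.

Let mxw : measurable_fun [set: (R * X) * W] (fun z => (z.1.2, z.2)).
Proof. by apply: measurable_fun_pair => //; exact: measurableT_comp. Qed.

Let mG k : (k < M)%N ->
  measurable_fun [set: (R * X) * W] (fun z => G k z.1 z.2).
Proof.
move=> kM; apply: measurable_fun_pair.
  apply: measurable_funM; first exact: measurableT_comp.
  exact: (measurableT_comp (mA kM) mxw).
exact: (measurableT_comp (mg kM) mxw).
Qed.

(** Both coordinates are measurable at once because together they form the chain driven by [G]. *)
Let mchain k : (k <= M)%N ->
  measurable_fun [set: Om] (fun om => (\1_(survival k) om : R, chain w g x0 k om)).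
Proof.
move=> kM; rewrite (_ : (fun _ => _) = chain w G (1%R, x0) k).
  exact: (@measurable_chain _ _ _ _ (R * X)%type _ _ _ _ _ mw mG _ kM).
by apply/funext => om; rewrite chain_survival.
Qed.

Lemma measurable_survival k : (k <= M)%N -> measurable (survival k).
Proof.
move=> kM; apply/(measurable_indicP R).
exact: (measurableT_comp measurable_fst (mchain kM)).
Qed.

Let integrand_ge0 k x e : (k < M)%N -> 0 <= (\1_(A k e) x)%:E * v k.+1 (g k x e).
Proof. by move=> kM; rewrite mule_ge0 ?lee_fin ?v0. Qed.

Let measurable_integrand k : (k < M)%N -> measurable_fun [set: X * W]
  (fun z => (\1_(A k z.2) z.1)%:E * v k.+1 (g k z.1 z.2)).
Proof.
move=> kM; apply: emeasurable_funM; first by apply/measurable_EFinP; exact: mA.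
exact: (measurableT_comp (mv kM) (mg kM)).
Qed.

Lemma one_step_value_ge0 k x : (k < M)%N -> 0 <= one_step_value k x.
Proof. by move=> kM; apply: integral_ge0 => e _; exact: integrand_ge0. Qed.

Lemma measurable_one_step_value k : (k < M)%N ->
  measurable_fun [set: X] (one_step_value k).
Proof.
move=> kM; apply: (measurable_fun_fubini_tonelli_F _ (measurable_integrand kM)).
by move=> z; exact: integrand_ge0.
Qed.

Let measurable_on_survival k (h : X -> \bar R) : (k <= M)%N ->
  measurable_fun [set: X] h ->
  measurable_fun [set: Om] (fun om => (\1_(survival k) om)%:E * h (chain w g x0 k om)).
Proof.
move=> kM mh; apply: emeasurable_funM.
  by apply/measurable_EFinP/measurable_indicP; exact: measurable_survival.
exact: (measurableT_comp mh (measurableT_comp measurable_snd (mchain kM))).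
Qed.

(** One-step Markov property: [survivalS] splits off the constraint at rank [k], and [w k] is then
    integrated out conditionally on the augmented state at rank [k]. *)
Lemma expectation_survivalS k : (k < M)%N ->
  \int[P]_om ((\1_(survival k.+1) om)%:E * v k.+1 (chain w g x0 k.+1 om)) =
  \int[P]_om ((\1_(survival k) om)%:E * one_step_value k (chain w g x0 k om)).
Proof.
move=> kM.
(* The first coordinate ranges over all of [R], while [h] must be nonnegative everywhere; on the
   chain this coordinate is an indicator, so the absolute value changes nothing. *)
pose h (z : (R * X) * W) := (`|z.1.1|)%:E *
  ((\1_(A k z.2) z.1.2)%:E * v k.+1 (g k z.1.2 z.2)).
have h0 z : 0 <= h z by rewrite mule_ge0 ?lee_fin ?integrand_ge0.
have mh : measurable_fun setT h.
  apply: emeasurable_funM.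
    apply/measurable_EFinP; apply: measurableT_comp => //.
    exact: measurableT_comp.
  exact: (measurableT_comp (measurable_integrand kM) mxw).
have := @expectation_chain _ _ _ _ (R * X)%type _ _ _ _ _ _ _ (1%R, x0)
  mw mG wP _ h kM mh h0.
under eq_integral do rewrite chain_survival.
under [RHS]eq_integral do under eq_integral do rewrite chain_survival.
move=> hE; transitivity (\int[P]_x h ((\1_(survival k) x, chain w g x0 k x), w k x)).
  apply: eq_integral => om _.
  by rewrite survivalS EFinM -muleA /h /= ger0_norm.
rewrite hE; apply: eq_integral => om _.
rewrite /h /= ger0_norm// ge0_integralZl//.
- have mx : measurable_fun [set: W] (fun e => (chain w g x0 k om, e)).
    exact: measurable_fun_pair.
  exact: (measurableT_comp (measurable_integrand kM) mx).
- by move=> e _; exact: integrand_ge0.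
Qed.

Hypothesis vM : forall x, v M x = 1.

Let expectation_survival0 :
  \int[P]_om ((\1_(survival 0) om)%:E * v 0%N (chain w g x0 0 om)) = v 0%N x0.
Proof.
rewrite -[RHS]mule1 -(probability_setT P) -integral_cst//.
by apply: eq_integral => om _; rewrite indicE mem_set// mul1e.
Qed.

Let expectation_survivalM :
  \int[P]_om ((\1_(survival M) om)%:E * v M (chain w g x0 M om)) = P (survival M).
Proof.
under eq_integral do rewrite vM mule1.
by rewrite integral_indic ?setIT//; exact: measurable_survival.
Qed.

(** Supermartingale argument: the expectation of [v k] at the state of rank [k], on [survival k],
    does not increase with [k]. It is [v 0 x0] at rank [0] and the survival probability at rank
    [M]. *)
Lemma survival_le_value :
  (forall k x, (k < M)%N -> one_step_value k x <= v k x) ->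
  P (survival M) <= v 0%N x0.
Proof.
move=> super; rewrite -expectation_survivalM -expectation_survival0.
(* Induction on a rank [k] bounded by the fixed horizon [M]. *)
elim: {-2}M (leqnn M) => // k IH kM.
apply: le_trans (IH (ltnW kM)); rewrite expectation_survivalS//.
apply: ge0_le_integral => //.
- by move=> om _; rewrite mule_ge0 ?lee_fin ?one_step_value_ge0.
- by apply: measurable_on_survival; [exact: ltnW|exact: measurable_one_step_value].
- by apply: measurable_on_survival; [|apply: mv]; exact: ltnW.
- by move=> om _; rewrite lee_wpmul2l ?lee_fin ?super.
Qed.

(** Martingale case: the same expectation is constant in [k]. *)
Lemma survival_eq_value :
  (forall k x, (k < M)%N -> one_step_value k x = v k x) ->
  P (survival M) = v 0%N x0.
Proof.
move=> mart; rewrite -expectation_survivalM -expectation_survival0.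
elim: {-2}M (leqnn M) => // k IH kM; rewrite -IH ?(ltnW kM)//.
by rewrite expectation_survivalS//; apply: eq_integral => om _; rewrite mart.
Qed.

End survival.

(** * From integer times and scenarios to noises indexed by ranks *)

Lemma iid_joint_law d d' (Om : measurableType d) (E : measurableType d')
    (R : realType) (P : probability Om R) (t0 T : int) (X : int -> Om -> E)
    (mu : probability E R) (F : nat -> set E) :
  t0 <= T -> iid P [set t : int | t0 <= t <= T] X mu ->
  (forall k, measurable (F k)) ->
  (P (\bigcap_(k in `I_(absz (T - t0)).+1) (X (t0 + k%:Z)%R @^-1` F k)) =
   \prod_(0 <= k < (absz (T - t0)).+1) mu (F k))%E.
Proof.
move=> t0T [Xindep Xdistr] mF.
set N := absz (T - t0).
have NE : N%:Z = T - t0 by rewrite /N gez0_abs// subr_ge0.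
have rangeE k : (k < N.+1)%N -> t0 <= t0 + k%:Z <= T.
  by move=> kN; apply/andP; split; lia.
(* [mutually_independent] speaks of finite sets of times. Since [s] has no duplicates, the product
   over the set [J] built from it is a product over ranks. *)
pose s := [seq t0 + k%:Z | k <- index_iota 0 N.+1].
have sP t : reflect (exists2 k, (k < N.+1)%N & t = t0 + k%:Z) (t \in s).
  apply: (iffP mapP) => -[k]; rewrite ?mem_index_iota => kN ->; exists k => //.
  by rewrite mem_index_iota.
have sU : uniq s.
  by rewrite map_inj_uniq ?iota_uniq// => i j /addrI[].
pose J := seq_fset tt s.
pose F' t := F (absz (t - t0)).
have F'E k : F' (t0 + k%:Z) = F k by rewrite /F' addrC addKr absz_nat.
have JE : [set` J] `<=` [set t : int | t0 <= t <= T].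
  by move=> t /=; rewrite seq_fsetE => /sP[k kN ->]; exact: rangeE.
have := Xindep J F' JE (fun t => mF _).
rewrite (perm_big _ (seq_fset_perm _ _)) undup_id// big_map.
rewrite (_ : \bigcap_(t in [set` J]) _ =
    \bigcap_(k in `I_N.+1) (X (t0 + k%:Z) @^-1` F k)); last first.
  apply/seteqP; split => [om XF k kN|om XF t /=].
    rewrite -F'E; apply: XF => /=; rewrite seq_fsetE; apply/sP.
    by exists k.
  by rewrite seq_fsetE => /sP[k kN ->]; rewrite F'E; exact: XF.
move=> ->; rewrite big_nat_cond [RHS]big_nat_cond.
apply: eq_bigr => k /andP[/andP[_ kN] _].
by rewrite F'E Xdistr//=; exact: rangeE.
Qed.

Lemma measurable_disturbance (R : realType) (q : nat) (t0 T : int)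
    (S : int -> set (q.-tuple R)) (Omega_neq0 : scenario_set t0 T S !=set0)
    (t : int) :
  measurable_fun [set: scenario Omega_neq0]
    (@disturbance R q t0 T S Omega_neq0 t).
Proof.
have mval : measurable_fun [set: scenario Omega_neq0]
    (@scenario_val R q t0 T S Omega_neq0 :
      _ -> (absz (T - t0)).+1.-tuple (q.-tuple R)).
  (* The trace sigma-field consists of preimages under [scenario_val]. *)
  by move=> _ Y mY; exists Y.
exact: (measurableT_comp (measurable_tnth _) mval).
Qed.

(** * The dynamic programming equation in terms of time *)

Section value_function.
Context (R : realType) (n p q : nat) (t0 T : int)
  (f : int -> n.-tuple R -> p.-tuple R -> q.-tuple R -> n.-tuple R)
  (B : int -> n.-tuple R -> set (p.-tuple R))
  (A : int -> q.-tuple R -> set (n.-tuple R))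
  (mu : probability (q.-tuple R) R).
Local Notation V := (value_function T f B A mu).

Lemma value_functionT x : V T x = (\int[mu]_w (\1_(A T w) x)%:E)%E.
Proof. by rewrite /value_function subrr. Qed.

Lemma value_functionS t x : t < T ->
  V t x = ereal_sup [set expected_value f A mu (V (t + 1)) t x u | u in B t x].
Proof.
move=> tT; rewrite /value_function.
(* [value_to_go] counts remaining steps: [t < T] makes this count a successor, and subtracting it
   from [T] gives back [t]. *)
have -> : absz (T - t) = (absz (T - (t + 1))%R).+1 by lia.
have tE : T - (absz (T - (t + 1))%R).+1%:Z = t by lia.
by rewrite /= tE.
Qed.

Lemma value_function_ge0 : (forall t x, t0 <= t < T -> B t x !=set0) ->
  forall t x, t0 <= t <= T -> (0 <= V t x)%E.
Proof.
move=> hB t x tT; have [k kE] : exists k : nat, T = t + k%:Z.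
  by exists (absz (T - t)); lia.
elim: k t x kE tT => [|k IH] t x kE tT.
  have -> : t = T by lia.
  by rewrite value_functionT; apply: integral_ge0 => w _; rewrite lee_fin.
rewrite value_functionS; last by lia.
(* An admissible control is needed because the supremum of the empty set is [-oo]. *)
have [u Bu] := hB t x ltac:(lia).
apply: le_trans (ereal_sup_ubound _); last by exists u.
apply: integral_ge0 => w _; rewrite mule_ge0 ?lee_fin ?IH//; lia.
Qed.

Lemma value_function_argmax t x u : t < T ->
  viability_argmax T f B A mu t x u ->
  V t x = expected_value f A mu (V (t + 1)) t x u.
Proof.
move=> tT [Bu umax]; rewrite value_functionS//; apply/eqP; rewrite eq_le.
apply/andP; split; last by apply: ereal_sup_ubound; exists u.
by apply: ge_ereal_sup => _ [v Bv <-]; exact: umax.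
Qed.

End value_function.

(** * Viability probability of a feedback against the value function *)

Section viability_probability.
Context (R : realType) (n p q : nat) (t0 T : int)
  (f : int -> n.-tuple R -> p.-tuple R -> q.-tuple R -> n.-tuple R)
  (B : int -> n.-tuple R -> set (p.-tuple R))
  (A : int -> q.-tuple R -> set (n.-tuple R))
  (S : int -> set (q.-tuple R)) (Omega_neq0 : scenario_set t0 T S !=set0)
  (P : probability (scenario Omega_neq0) R) (mu : probability (q.-tuple R) R).
Hypothesis t0T : t0 < T.
Hypothesis B_neq0 : forall (t : int) (x : n.-tuple R), t0 <= t < T -> B t x !=set0.
Hypothesis mf : forall t : int, t0 <= t < T ->
    measurable_fun [set: n.-tuple R * p.-tuple R * q.-tuple R]
      (fun z => f t z.1.1 z.1.2 z.2).
Hypothesis mA : forall t : int, t0 <= t <= T ->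
    measurable_fun [set: n.-tuple R * q.-tuple R]
      (fun z => \1_(A t z.2) z.1 : R).
Hypothesis mV : forall t : int, t0 <= t <= T ->
    measurable_fun [set: n.-tuple R] (value_function T f B A mu t).
Hypothesis hiid : iid P [set t : int | t0 <= t <= T]
    (fun t => @disturbance R q t0 T S Omega_neq0 t) mu.
Variables (x0 : n.-tuple R) (u : int -> n.-tuple R -> p.-tuple R).
Hypothesis fb_u : feedback t0 T u.

Local Notation V := (value_function T f B A mu).
Let N := absz (T - t0).
Let NE : N%:Z = T - t0. Proof. by rewrite /N; lia. Qed.

Let w (k : nat) : scenario Omega_neq0 -> q.-tuple R := disturbance (t0 + k%:Z).
(* After the final time the state is frozen and the value is 1, so that the
   terminal value is a one-step value as well. *)
Let g (k : nat) (x : n.-tuple R) (e : q.-tuple R) : n.-tuple R :=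
  if (k < N)%N then f (t0 + k%:Z) x (u (t0 + k%:Z) x) e else x.
Let Ak (k : nat) : q.-tuple R -> set (n.-tuple R) := A (t0 + k%:Z).
Let v (k : nat) (x : n.-tuple R) : \bar R :=
  if (k <= N)%N then V (t0 + k%:Z) x else 1%E.

Let chain_state k om : (k <= N)%N ->
  chain w g x0 k om = state_after t0 f x0 u (fun s => disturbance s om) k.
Proof.
by elim: k => //= k IH kN; rewrite IH ?(ltnW kN)// /g kN.
Qed.

(** The horizon is [N.+1], not [N]: ranks [0] to [N] are the times [t0] to [T], so the target
    constraint at [T] is included. *)
Let survivalE : survival w g Ak x0 N.+1 = viable_scenarios f A x0 u.
Proof.
have rankE (k : nat) : absz (t0 + k%:Z - t0)%R = k by lia.
apply/seteqP; split=> om /= H => [t tT|k kN].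
  have -> : t = t0 + (absz (t - t0))%:Z by lia.
  have kN : (absz (t - t0) <= N)%N by lia.
  have := H (absz (t - t0)) kN.
  by rewrite chain_state// /state_path rankE.
have := H (t0 + k%:Z) ltac:(lia).
by rewrite chain_state// /state_path rankE.
Qed.

Let mw k : measurable_fun [set: scenario Omega_neq0] (w k).
Proof. exact: measurable_disturbance. Qed.

Let mg k : (k < N.+1)%N ->
  measurable_fun [set: n.-tuple R * q.-tuple R] (fun z => g k z.1 z.2).
Proof.
rewrite /g; case: (ltnP k N) => kN _; last exact: measurable_fst.
have mxuw : measurable_fun [set: n.-tuple R * q.-tuple R]
    (fun z => (z.1, u (t0 + k%:Z) z.1, z.2)).
  apply: measurable_fun_pair => //; apply: measurable_fun_pair => //.
  by apply: measurableT_comp => //; apply: fb_u; lia.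
exact: (measurableT_comp (mf (t := t0 + k%:Z) ltac:(lia)) mxuw).
Qed.

Let mAk k : (k < N.+1)%N ->
  measurable_fun [set: n.-tuple R * q.-tuple R] (fun z => \1_(Ak k z.2) z.1 : R).
Proof. by move=> kN; apply: mA; lia. Qed.

Let mv k : (k <= N.+1)%N -> measurable_fun [set: n.-tuple R] (v k).
Proof.
rewrite /v; case: (leqP k N) => kN _; last exact: measurable_cst.
by apply: mV; lia.
Qed.

Let v_ge0 k x : (k <= N.+1)%N -> (0 <= v k x)%E.
Proof.
rewrite /v; case: (leqP k N) => // kN _.
by apply: (value_function_ge0 (t0 := t0)) => //; lia.
Qed.

Let vN x : v N.+1 x = 1%E.
Proof. by rewrite /v ltnn. Qed.

Let v0E : v 0 x0 = V t0 x0.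
Proof. by rewrite /v addr0. Qed.

Let one_step_valueN x : one_step_value mu g Ak v N x = v N x.
Proof.
rewrite {2}/v leqnn NE addrC subrK value_functionT /one_step_value.
by apply: eq_integral => e _; rewrite vN mule1 /Ak NE addrC subrK.
Qed.

Let one_step_valueE k x : (k < N)%N ->
  one_step_value mu g Ak v k x =
  expected_value f A mu (V (t0 + k%:Z + 1)) (t0 + k%:Z) x (u (t0 + k%:Z) x).
Proof.
move=> kN; apply: eq_integral => e _.
by rewrite /v kN /g kN -addn1 PoszD addrA.
Qed.

Let joint F := iid_joint_law (F := F) (ltW t0T) hiid.

(** A control in [B t x] does no better than the supremum defining the value, which gives the
    supermartingale inequality; at the last rank it is an equality. *)
Lemma viability_le_value : (forall t x, t0 <= t < T -> B t x (u t x)) ->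
  (P (viable_scenarios f A x0 u) <= V t0 x0)%E.
Proof.
move=> Bu; rewrite -survivalE -v0E.
apply: (survival_le_value x0 mw joint mg mAk mv v_ge0 vN) => k x.
rewrite ltnS leq_eqVlt => /predU1P[->|kN]; first by rewrite one_step_valueN.
rewrite one_step_valueE// /v (ltnW kN) value_functionS; last by lia.
by apply: ereal_sup_ubound; exists (u (t0 + k%:Z) x) => //; apply: Bu; lia.
Qed.

(** A maximizer attains the supremum, which gives the martingale case. *)
Lemma viability_eq_value :
  (forall t x, t0 <= t < T -> viability_argmax T f B A mu t x (u t x)) ->
  P (viable_scenarios f A x0 u) = V t0 x0.
Proof.
move=> u_max; rewrite -survivalE -v0E.
apply: (survival_eq_value x0 mw joint mg mAk mv v_ge0 vN) => k x.
rewrite ltnS leq_eqVlt => /predU1P[->|kN]; first by rewrite one_step_valueN.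
rewrite one_step_valueE// /v (ltnW kN); apply/esym/value_function_argmax.
  by lia.
by apply: u_max; lia.
Qed.

End viability_probability.

Theorem proposition3 (R : realType) (n p q : nat) (t0 T : int)
  (f : int -> n.-tuple R -> p.-tuple R -> q.-tuple R -> n.-tuple R)
  (B : int -> n.-tuple R -> set (p.-tuple R))
  (A : int -> q.-tuple R -> set (n.-tuple R))
  (S : int -> set (q.-tuple R)) (Omega_neq0 : scenario_set t0 T S !=set0)
  (P : probability (scenario Omega_neq0) R) (mu : probability (q.-tuple R) R)
  (beta : R)
  (ht0T : t0 < T) (hbeta : 0 < beta <= 1)
  (hB : forall (t : int) (x : n.-tuple R), t0 <= t < T -> B t x !=set0)
  (hA : forall (t : int) (w : q.-tuple R), t0 <= t <= T -> A t w !=set0)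
  (mf : forall t : int, t0 <= t < T ->
    measurable_fun [set: n.-tuple R * p.-tuple R * q.-tuple R]
      (fun z => f t z.1.1 z.1.2 z.2))
  (mA : forall t : int, t0 <= t <= T ->
    measurable_fun [set: n.-tuple R * q.-tuple R]
      (fun z => \1_(A t z.2) z.1 : R))
  (mV : forall t : int, t0 <= t <= T ->
    measurable_fun [set: n.-tuple R] (value_function T f B A mu t))
  (hiid : iid P [set t : int | t0 <= t <= T]
    (fun t => @disturbance R q t0 T S Omega_neq0 t) mu)
  (hargmax : forall (t : int) (x : n.-tuple R), t0 <= t < T ->
    viability_argmax T f B A mu t x !=set0) :
  forall x0 : n.-tuple R, viability_kernel f B A P beta x0 ->
  forall ustar : int -> n.-tuple R -> p.-tuple R,
    feedback t0 T ustar ->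
    (forall (t : int) (x : n.-tuple R), t0 <= t < T -> viability_argmax T f B A mu t x (ustar t x)) ->
    viable_feedback f B A P beta x0 ustar.
Proof.
move=> x0 [u [[fb_u Bu] beta_le]] ustar m_ustar ustar_max.
split.
  by split=> // t x tT; have [] := ustar_max t x tT.
(* The value at [(t0, x0)] is the viability probability of [ustar], and it bounds that of the
   kernel's witness [u], which is at least [beta]. *)
rewrite (viability_eq_value ht0T hB mf mA mV hiid x0 m_ustar ustar_max).
apply: (le_trans beta_le).
exact: (viability_le_value ht0T hB mf mA mV hiid x0 fb_u Bu).
Qed.
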